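(* Let $d\ge 4$ be an integer and let $G$ be a graph on $n$ vertices with minimum degree $\delta(G)\ge d$. Then $$\gamma_g(G)\le \frac{30d^4-56d^3-258d^2+708d-432}{90d^4-390d^3+348d^2+348d-432}\; n.$$
   Context: Graphs are finite, simple and undirected; $\delta(G)$ is the minimum degree of $G=(V,E)$. For $v\in V$, $N(v)=\{u: uv\in E\}$ and $N[v]=N(v)\cup\{v\}$; for $S\subseteq V$, $N[S]=\bigcup_{v\in S}N[v]$ is the set of vertices dominated by $S$. The domination game on $G$: two players, Dominator and Staller, alternately select a vertex of $G$. If $D$ is the set of vertices selected so far (by both players), then selecting $v$ is legal if and only if it dominates at least one new vertex, i.e. $N[v]\not\subseteq N[D]$. The game ends when no legal move exists, equivalently when $N[D]=V$. The length of the game is the total number of vertices selected (the number of turns, a turn being one move of one player). Dominator wants to minimize the length and Staller wants to maximize it. The game domination number $\gamma_g(G)$ is the length of the game when Dominator makes the first move and both players play optimally. *)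

(* Defs.v *)
From mathcomp Require Import all_boot.

Set Implicit Arguments.
Unset Strict Implicit.
Unset Printing Implicit Defensive.

(* A finite simple undirected graph is a symmetric irreflexive
   relation e on a finType T. *)

Lemma bigminn_leq_cond (I : finType) (P : pred I) (F : I -> nat) m i0 :
  P i0 -> \big[minn/m]_(i | P i) F i <= F i0.
Proof.
move=> Pi0; have := mem_index_enum i0.
elim: (index_enum I) => // i r IH; rewrite inE big_cons.
case/predU1P => [<-|/IH le]; first by rewrite Pi0 geq_minl.
by case: (P i) => //; apply: leq_trans (geq_minr _ _) le.
Qed.

Section DominationGame.

Variables (T : finType) (e : rel T).
Implicit Types (v : T) (D S : {set T}) (k : nat).

Definition nbh v : {set T} := [set u | e v u].

Definition cnbh v : {set T} := v |: nbh v.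

Definition dominated S : {set T} := \bigcup_(v in S) cnbh v.

Definition degree v : nat := #|nbh v|.

(* Degrees never exceed #|T|, so the default value of the minimum only matters
   for the graph without vertices, whose minimum degree is 0 here. *)
Definition min_degree : nat := \big[minn/#|T|]_(v : T) degree v.

(* D is the set of vertices selected so far, by both players. *)
Definition legal D v : bool := ~~ (cnbh v \subset dominated D).

(* Backward induction: the number of turns still to be played from D under
   optimal play, where dom tells whether Dominator is to move; k caps the
   number of turns.  Each turn dominates a new vertex, so the cap is never
   reached when k = #|T| (see game_length_nolegal, game_length_dominator and
   game_length_staller, where no cap and no default value appear). *)
Fixpoint capped_length k (dom : bool) D : nat :=
  if k is k'.+1 then
    if [exists v, legal D v] then
      (if dom
       then \big[minn/#|T|]_(v | legal D v) capped_length k' false (v |: D)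
       else \max_(v | legal D v) capped_length k' true (v |: D)).+1
    else 0
  else 0.

Definition game_length (dom : bool) D : nat := capped_length #|T| dom D.

Definition game_domination_number : nat := game_length true set0.

Lemma dominatedU1 v D : dominated (v |: D) = cnbh v :|: dominated D.
Proof. by rewrite /dominated bigcup_setU big_set1. Qed.

Lemma legal_card v D :
  legal D v -> #|~: dominated (v |: D)| < #|~: dominated D|.
Proof.
move=> lv; apply: proper_card; rewrite dominatedU1 properE !setCS subsetUr /=.
by rewrite subUset subxx andbT.
Qed.

Lemma capped_length_irr k dom D :
  #|~: dominated D| <= k -> capped_length k dom D = game_length dom D.
Proof.
rewrite /game_length; have: #|~: dominated D| <= #|T| by apply: max_card.
move: #|T| => m; elim: k m dom D => [|k IH] [|m] dom D //= hm hk.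
- case: existsP => // -[v /legal_card]; move: hk; rewrite leqn0 => /eqP ->.
  by rewrite ltn0.
- case: existsP => // -[v /legal_card]; move: hm; rewrite leqn0 => /eqP ->.
  by rewrite ltn0.
case: ifP => // _; congr _.+1.
have E b v : legal D v ->
    capped_length k b (v |: D) = capped_length m b (v |: D).
  by move=> /legal_card lt; apply: IH; rewrite -ltnS; apply: leq_trans lt _.
by case: dom; apply: eq_bigr => v lv; apply: E.
Qed.

Lemma game_length_le dom D : game_length dom D <= #|~: dominated D|.
Proof.
rewrite -(capped_length_irr dom (leqnn #|~: dominated D|)).
move: #|_| => k; elim: k dom D => [|k IH] dom D //=.
case: existsP => // -[v0 lv0].
case: dom; last by apply/bigmax_leqP => v _; apply: IH.
by rewrite ltnS; apply: leq_trans (bigminn_leq_cond _ _ lv0) (IH _ _).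
Qed.

Lemma game_length_unfold dom D v0 : legal D v0 ->
  game_length dom D =
  (if dom
   then \big[minn/#|T|]_(v | legal D v) game_length false (v |: D)
   else \max_(v | legal D v) game_length true (v |: D)).+1.
Proof.
move=> lv0; have ex : [exists v, legal D v] by apply/existsP; exists v0.
rewrite -(@capped_length_irr #|~: dominated D|.+1) ?leqnSn //= ex.
congr _.+1; have E b v : legal D v ->
    capped_length #|~: dominated D| b (v |: D) = game_length b (v |: D).
  by move=> /legal_card /ltnW; apply: capped_length_irr.
by case: dom; apply: eq_bigr => v lv; apply: E.
Qed.

Lemma game_length_nolegal dom D :
  (forall v, ~~ legal D v) -> game_length dom D = 0.
Proof.
move=> nl; rewrite /game_length; case: #|T| => //= k.
by case: existsP => // -[v]; rewrite (negbTE (nl v)).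
Qed.

Lemma game_length_dominator D v0 : legal D v0 ->
  (forall v, legal D v -> game_length true D <= (game_length false (v |: D)).+1)
  /\ exists2 v, legal D v & game_length true D = (game_length false (v |: D)).+1.
Proof.
move=> lv0; rewrite (game_length_unfold true lv0); split=> [v lv|].
  by rewrite ltnS; apply: (bigminn_leq_cond _ _ lv).
case: (arg_minnP (fun v => game_length false (v |: D)) lv0) => v lv minv.
exists v => //; congr _.+1; apply/eqP; rewrite eqn_leq; apply/andP; split.
  by apply: (bigminn_leq_cond _ _ lv).
apply: (big_ind (fun x => game_length false (v |: D) <= x)) => //.
- exact: leq_trans (game_length_le _ _) (max_card _).
- by move=> x y hx hy; rewrite leq_min hx.
Qed.

Lemma game_length_staller D v0 : legal D v0 ->
  (forall v, legal D v -> (game_length true (v |: D)).+1 <= game_length false D)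
  /\ exists2 v, legal D v & game_length false D = (game_length true (v |: D)).+1.
Proof.
move=> lv0; rewrite (game_length_unfold false lv0); split=> [v lv|].
  by rewrite ltnS; apply: leq_bigmax_cond.
case: (@eq_bigmax_cond _ (legal D) (fun v => game_length true (v |: D))).
  by apply/card_gt0P; exists v0.
by move=> v lv ->; exists v.
Qed.

End DominationGame.

(* Main.v *)
Require Import Defs.
From mathcomp Require Import all_boot all_order all_algebra.
From mathcomp Require Import ring lra.

Set Implicit Arguments.
Unset Strict Implicit.
Unset Printing Implicit Defensive.

Import Order.TTheory GRing.Theory Num.Theory.

Local Open Scope ring_scope.

(** The bound comes from a potential that Dominator can drive down fast enough.
    Call a vertex white if it is not yet dominated, and blue if it is dominated
    but still has a white neighbour.  Give weight a to every white vertex and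
    weight c + y w to a blue vertex with w white neighbours: apart from the
    vertex weights, every edge between a blue and a white vertex is worth y.
    At the start all n vertices are white and the potential is a n, so it is
    enough that Dominator can make the potential fall by 2 s in each pair of
    turns, where a and s are the numerator and the denominator of the claimed
    ratio; then s times the length of the game is at most a n.

    When a white vertex u becomes dominated, the potential loses a, gains at
    most the weight of u as a blue vertex, and loses y for each of the at least
    d - w blue neighbours of u, where w counts its white ones (move_drop).  So if white vertices have at
    most m white neighbours, any move costs at least a + y (d - 2m)
    (any_move_drop), and if some move dominates more than m new vertices, then
    Dominator has one that costs much more (rich_move_drop).

    One pair (c, y) cannot be good throughout the game: while moves can
    dominate many vertices, the weights a suffice, and at the end the edges
    between blue and white vertices have to make up for the poor moves.  Hence
    there are levels m = 4, 3, 2, 1, 0, where on level m < 4 no move dominates more than m + 1 new vertices.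
    With Y m the value of an edge on level m (Y 4 = 0), the weight of a blue
    vertex with m white neighbours is set to Y 0 + ... + Y (m - 1) on level m.
    Dominator plays a rich move as long as one exists; once every move
    dominates at most m new vertices, the game passes to level m - 1.  As Y is
    nonincreasing, this change of weights never raises the potential
    (level_potentialS), and an induction gives the bound (game_bound).

    On level m, these drops for one turn of each player add up to at
    least 2 s if
      2 s <= (m + 2) a - m (Y 0 + ... + Y (m - 1)) + (m + 2) (d - m) Y m.
    The values of Y are chosen so that this is an equality for m = 0, 2, 3, 4;
    together with 2 s = 3 a + (3 d - 6) Y 1, which is slightly stronger than
    the case m = 1, these equations determine the ratio a / s. *)

(** * White vertices and the effect of a move on them *)

Section Weights.

Variables (T : finType) (e : rel T).
Implicit Types (v x u : T) (D : {set T}).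

Definition white D : {set T} := ~: dominated e D.

Definition wdeg D x : nat := #|nbh e x :&: white D|.

Definition newly v D : {set T} := cnbh e v :&: white D.

Lemma in_newly v D x :
  (x \in newly v D) = ((x == v) || e v x) && (x \in white D).
Proof. by rewrite !inE. Qed.

Lemma whiteU1 v D : white (v |: D) = white D :\: newly v D.
Proof.
apply/setP=> x; rewrite /white /newly dominatedU1 !inE.
by case: (x \in dominated e D); rewrite ?orbT ?andbF ?orbF ?andbT.
Qed.

Lemma legal_newly v D : legal e D v = (0 < #|newly v D|)%N.
Proof.
by rewrite /legal card_gt0 /newly /white -setDE setD_eq0.
Qed.

Lemma card_newly v D : irreflexive e ->
  #|newly v D| = ((v \in white D) + wdeg D v)%N.
Proof.
move=> irr; rewrite /newly /cnbh /wdeg setIUl cardsU.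
have -> : [set v] :&: white D :&: (nbh e v :&: white D) = set0.
  apply/setP=> x; rewrite !inE; apply/negP.
  by case/andP=> /andP[/eqP -> _] /andP[]; rewrite irr.
rewrite cards0 subn0; congr (_ + _)%N.
case: (boolP (v \in white D)) => [vW|vW].
  by rewrite (setIidPl _) ?sub1set // cards1.
by apply/eqP; rewrite cards_eq0 setI_eq0 disjoints1.
Qed.

Lemma wdegU1 v D x :
  wdeg D x = (wdeg (v |: D) x + #|nbh e x :&: newly v D|)%N.
Proof.
rewrite /wdeg whiteU1 setIDA addnC -[LHS](cardsID (newly v D)).
by rewrite -setIA (setIidPr (subsetIr (cnbh e v) (white D) : newly v D \subset _)).
Qed.

(** When the played vertex is itself white, its neighbours lose it as a white
    neighbour.  This is why white choices are attractive for Dominator. *)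
Lemma wdeg_newly_lt v D u : symmetric e ->
  v \in white D -> u \in newly v D -> u != v ->
  (wdeg (v |: D) u < wdeg D u)%N.
Proof.
move=> sym vW uU uv; rewrite (wdegU1 v D u) -addn1 leq_add2l card_gt0.
apply/set0Pn; exists v; rewrite !inE eqxx /= sym.
by move: uU vW; rewrite !inE (negbTE uv) /= => /andP[-> _].
Qed.

Lemma newly_self v D : v \in white D -> v \in newly v D.
Proof. by rewrite in_newly eqxx. Qed.

Lemma wdeg_moved v D : wdeg (v |: D) v = 0%N.
Proof.
apply/eqP; rewrite /wdeg whiteU1 cards_eq0; apply/eqP/setP=> x.
by rewrite !inE; case: (e v x); rewrite ?orbT //=; case: (x \in _).
Qed.

(** * The potential and its drop in one move *)

Section Potential.

Variables (a c y : rat).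

(** Dominated vertices whose neighbours are all dominated cannot matter any more
    and get weight 0: the constant c disappears together with the last white
    neighbour. *)
Definition blue_weight (w : nat) : rat := c *+ (0 < w)%N + y * w%:R.

Definition weight D x : rat :=
  if x \in white D then a else blue_weight (wdeg D x).

Definition potential D : rat := \sum_x weight D x.

Hypotheses (c_ge0 : 0 <= c) (y_ge0 : 0 <= y) (a_ge0 : 0 <= a).

Lemma blue_weight_ge0 w : 0 <= blue_weight w.
Proof. by rewrite addr_ge0 ?mulrn_wge0 ?mulr_ge0. Qed.

Lemma blue_weight0 : blue_weight 0 = 0.
Proof. by rewrite /blue_weight mulr0 addr0. Qed.

Lemma blue_weight_le w : blue_weight w <= c + y * w%:R.
Proof. by rewrite lerD2r; case: (0 < w)%N. Qed.

Lemma potential_ge0 D : 0 <= potential D.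
Proof.
by apply: sumr_ge0 => x _; rewrite /weight; case: ifP => // _; apply: blue_weight_ge0.
Qed.

Lemma potential_set0 : potential set0 = a * #|T|%:R.
Proof.
rewrite /potential (eq_bigr (fun=> a)) ?sumr_const ?cardT ?mulr_natr -?cardT //.
by move=> x _; rewrite /weight /white /dominated big_set0 setC0 inE.
Qed.

Lemma blue_weight_drop v D x : blue_weight (wdeg (v |: D) x) +
    y * #|nbh e x :&: newly v D|%:R <= blue_weight (wdeg D x).
Proof.
rewrite /blue_weight (wdegU1 v D x) natrD mulrDr addrA !lerD2r.
by case: (wdeg (v |: D) x) => // *; rewrite mulr0n mulrn_wge0.
Qed.

(** Double counting of the edges between the newly dominated vertices and the
    vertices that were already dominated. *)
Lemma edge_count v D : symmetric e ->
  \sum_(x | x \notin white D) #|nbh e x :&: newly v D|%:R =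
  \sum_(u in newly v D) #|nbh e u :\: white D|%:R :> rat.
Proof.
move=> sym.
have cardE (A : {set T}) : #|A|%:R = \sum_(x in A) 1 :> rat.
  by rewrite sumr_const.
under eq_bigr do rewrite cardE big_mkcond.
under [RHS]eq_bigr do rewrite cardE big_mkcond.
rewrite big_mkcond [RHS]big_mkcond /=.
under eq_bigr => x _.
  rewrite (_ : (if _ then _ else _) = \sum_u
    if [&& x \notin white D, e x u & u \in newly v D] then 1 else 0); last first.
    case: ifP => _; last by rewrite big1.
    by apply: eq_bigr => u _; rewrite in_setI [u \in nbh e x]in_set.
  over.
rewrite exchange_big /=; apply: eq_bigr => u _.
case: ifP => uU; last by rewrite big1 // => x _; rewrite !andbF.
by apply: eq_bigr => x _; rewrite andbT in_setD [x \in nbh e u]in_set sym.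
Qed.

Variable d : nat.
Hypothesis (sym : symmetric e) (irr : irreflexive e)
  (deg : forall x, (d <= degree e x)%N).

(** Each newly dominated u turns from white to blue, and each of its neighbours
    that was already dominated loses a white neighbour, hence at least y; there
    are at least d - wdeg D u of them.  The last term is there because a blue
    vertex that is played keeps no white neighbour, so it loses c as well. *)
Lemma move_drop v D : legal e D v ->
  \sum_(u in newly v D)
     (a - blue_weight (wdeg (v |: D) u) + y * (d%:R - (wdeg D u)%:R))
  + c *+ (v \notin white D)
  <= potential D - potential (v |: D).
Proof.
move=> lv.
(* The claimed drop, distributed over the vertices. *)
pose g x : rat :=
  (if x \in newly v D then a - blue_weight (wdeg (v |: D) x) else 0)
  + (if x \notin white D then y * #|nbh e x :&: newly v D|%:R else 0)
  + (if x == v then c *+ (v \notin white D) else 0).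
have le_g x : g x <= weight D x - weight (v |: D) x.
  rewrite /g /weight whiteU1 in_setD.
  have [xW|xW] := boolP (x \in white D).
    rewrite addr0 andbT; case: (boolP (x \in newly v D)) => xU /=.
      by case: eqP => [<-|_]; rewrite ?xW ?addr0.
    rewrite subrr add0r; case: eqP => // xv.
    by rewrite -xv xW.
  have -> : x \in newly v D = false by rewrite in_newly (negbTE xW) andbF.
  rewrite /= add0r; case: eqP xW => [-> vW|_ _]; last first.
    by rewrite addr0 lerBrDl blue_weight_drop.
  have wv : (0 < wdeg D v)%N.
    by have := lv; rewrite legal_newly card_newly // (negbTE vW).
  rewrite (negbTE vW) wdeg_moved blue_weight0 subr0 /blue_weight wv.
  by rewrite [in leRHS](wdegU1 v) wdeg_moved add0n addrC.
have : \sum_x g x <= \sum_x (weight D x - weight (v |: D) x).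
  exact: ler_sum.
rewrite sumrB /= -/(potential D) -/(potential (v |: D)); apply: le_trans.
rewrite [leRHS]big_split [X in _ <= X + _]big_split /= -!big_mkcond /=.
rewrite big_pred1_eq lerD2r [leLHS]big_split lerD2l.
rewrite -!mulr_sumr ler_wpM2l // edge_count // ler_sum // => u _.
rewrite lerBlDr -natrD ler_nat addnC /wdeg cardsID.
exact: deg.
Qed.

Variable m : nat.
Hypotheses (le_md : (m <= d)%N) (room : c + y * m%:R <= a).

Lemma dm_ge0 : 0 <= y * (d%:R - m%:R).
Proof. by rewrite mulr_ge0 // subr_ge0 ler_nat. Qed.

(** The weakest move dominates a single white vertex that has m white
    neighbours, from a blue vertex; what c takes away at the former it gives
    back at the latter.  The bound on wdeg is multiplied by y so that it is void
    when y = 0, where there is no bound on the number of white neighbours. *)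
Lemma any_move_drop v D : legal e D v ->
  {in white D, forall u, y * (wdeg D u)%:R <= y * m%:R} ->
  a + y * (d%:R - 2 * m%:R) <= potential D - potential (v |: D).
Proof.
move=> lv small; apply: le_trans (move_drop lv).
pose t u : rat := a - blue_weight (wdeg (v |: D) u) + y * (d%:R - (wdeg D u)%:R).
have le_t u : u \in newly v D -> a - c + y * (d%:R - 2 * m%:R) <= t u.
  rewrite in_newly => /andP[_ /small ym].
  have := blue_weight_le (wdeg (v |: D) u).
  have : y * (wdeg (v |: D) u)%:R <= y * (wdeg D u)%:R.
    by rewrite ler_wpM2l // ler_nat (wdegU1 v D u) leq_addr.
  rewrite /t !mulrBr; lra.
have t_ge0 u : u \in newly v D -> 0 <= t u.
  move=> /le_t; apply: le_trans; have := room; have := dm_ge0; rewrite !mulrBr; lra.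
change (a + y * (d%:R - 2 * m%:R) <= \sum_(u in newly v D) t u + c *+ (v \notin white D)).
have [vW|vW] := boolP (v \in white D).
  rewrite (bigD1 v (newly_self vW)) /= addr0.
  have tv : a + y * (d%:R - 2 * m%:R) <= t v.
    rewrite /t wdeg_moved blue_weight0 subr0 lerD2l.
    have := small _ vW; have : 0 <= y * m%:R by rewrite mulr_ge0.
    rewrite !mulrBr; lra.
  apply: le_trans tv _; rewrite lerDl sumr_ge0 // => u /andP[uU _].
  exact: t_ge0.
have [u uU] : exists u, u \in newly v D.
  by apply/set0Pn; rewrite -card_gt0 -legal_newly.
rewrite (bigD1 u uU) /= mulr1n.
have : 0 <= \sum_(x in newly v D | x != u) t x.
  by rewrite sumr_ge0 // => x /andP[xU _]; apply: t_ge0.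
have := le_t _ uU; lra.
Qed.

(** Dominator prefers a white vertex: then the m other newly dominated
    vertices keep at most m - 1 white neighbours.  If only blue vertices
    dominate more than m new vertices, then a white vertex, which dominates
    itself too, has at most m - 1 white neighbours already before the move, and
    the drop is even larger. *)
Lemma rich_move_drop D :
  {in white D, forall u, y * (wdeg D u)%:R <= y * m%:R} ->
  (exists x, (m < #|newly x D|)%N) ->
  exists2 v, legal e D v &
    a + y * (d%:R - m%:R) + m%:R * (a - c - y * (m%:R - 1) + y * (d%:R - m%:R))
      <= potential D - potential (v |: D).
Proof.
move=> small [x mx].
set t := a - c - y * (m%:R - 1) + y * (d%:R - m%:R).
have t_ge0 : 0 <= t.
  by have := dm_ge0; have := room; have := y_ge0; rewrite /t !mulrBr mulr1; lra.
have mono v u : y * (wdeg (v |: D) u)%:R <= y * (wdeg D u)%:R.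
  by rewrite ler_wpM2l // ler_nat (wdegU1 v D u) leq_addr.
case: (boolP [exists v in white D, (m < #|newly v D|)%N]).
  case/exists_inP => v vW mv; exists v.
    by rewrite legal_newly (leq_ltn_trans _ mv).
  have lv : legal e D v by rewrite legal_newly (leq_ltn_trans _ mv).
  apply: le_trans (move_drop lv); rewrite vW addr0.
  rewrite (bigD1 v (newly_self vW)) /= lerD //.
    rewrite wdeg_moved blue_weight0 subr0 lerD2l.
    by have := small _ vW; rewrite !mulrBr; lra.
  apply: (@le_trans _ _ (\sum_(u in newly v D :\ v) t)).
    rewrite sumr_const -[leRHS]mulr_natl ler_wpM2r // ler_nat.
    by move: mv; rewrite (cardsD1 v) newly_self.
  rewrite [leRHS](eq_bigl (fun u => u \in newly v D :\ v)); last first.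
    by move=> u; rewrite in_setD1 andbC.
  apply: ler_sum => u; rewrite in_setD1 => /andP[uv uU].
  have := blue_weight_le (wdeg (v |: D) u).
  have : y * ((wdeg (v |: D) u)%:R + 1) <= y * (wdeg D u)%:R.
    rewrite ler_wpM2l // natr1 ler_nat.
    exact: wdeg_newly_lt.
  have uW : u \in white D by move: uU; rewrite in_newly => /andP[].
  have := small _ uW.
  rewrite /t !mulrBr mulrDr mulr1; lra.
move=> /exists_inPn none.
have xW : x \notin white D.
  by apply/negP => /none; rewrite mx.
have lx : legal e D x by rewrite legal_newly (leq_ltn_trans _ mx).
exists x => //; apply: le_trans (move_drop lx); rewrite xW mulr1n.
apply: (@le_trans _ _ (\sum_(u in newly x D) (t + y) + c)).
  rewrite sumr_const -[(t + y) *+ _]mulr_natl.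
  have : m.+1%:R * (t + y) <= #|newly x D|%:R * (t + y).
    by apply: ler_wpM2r; [exact: addr_ge0 | rewrite ler_nat].
  have : a + y * (d%:R - m%:R) + m%:R * t <= m.+1%:R * (t + y) + c.
    have -> : m.+1%:R * (t + y) + c = m%:R * t + (t + c + y * m%:R + y).
      by rewrite -natr1; ring.
    rewrite addrC lerD2l /t !mulrBr mulr1; have := y_ge0; lra.
  lra.
rewrite lerD2r; apply: ler_sum => u uU.
have uW : u \in white D by move: uU; rewrite in_newly => /andP[].
have : y * ((wdeg D u)%:R + 1) <= y * m%:R.
  rewrite ler_wpM2l // natr1 ler_nat.
  by have := none _ uW; rewrite -leqNgt card_newly // uW.
have := blue_weight_le (wdeg (x |: D) u); have := mono x u.
rewrite /t !mulrBr mulrDr mulr1; lra.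
Qed.

End Potential.

(** * Levels and the strategy of Dominator *)

Section Levels.

Variables (d K : nat) (a s : rat) (Y : nat -> rat).

(** On level m, a blue vertex with m white neighbours has this weight, and each
    further or missing white neighbour changes it by Y m. *)
Definition full_weight (m : nat) : rat := \sum_(i < m) Y i.

Definition base_weight (m : nat) : rat := full_weight m - m%:R * Y m.

Definition level_potential m D : rat := potential a (base_weight m) (Y m) D.

Hypotheses (sym : symmetric e) (irr : irreflexive e).
Hypotheses (deg : forall x, (d <= degree e x)%N) (le_Kd : (K <= d)%N).
Hypotheses (Y_decr : forall i, (i < K)%N -> Y i.+1 <= Y i) (Y_top : Y K = 0).
Hypothesis (s_ge0 : 0 <= s).
Hypothesis (full_le_a : full_weight K <= a).
Hypothesis (pair_cost : forall m, (m <= K)%N ->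
  2 * s <= (m%:R + 2) * a - m%:R * full_weight m
           + (m%:R + 2) * (d%:R - m%:R) * Y m).

Lemma Y_ge0 m : (m <= K)%N -> 0 <= Y m.
Proof.
move=> /subnKC; move: (K - m)%N => j; elim: j m => [|j IH] m.
  by rewrite addn0 => ->; rewrite Y_top.
rewrite addnS -addSn => Em; apply: le_trans (IH _ Em) (Y_decr _).
by rewrite -Em leq_addr.
Qed.

Lemma full_weightS m : full_weight m.+1 = full_weight m + Y m.
Proof. exact: big_ord_recr. Qed.

Lemma full_weight_le m : (m <= K)%N -> full_weight m <= full_weight K.
Proof.
move=> mK; rewrite /full_weight -!(big_mkord xpredT).
rewrite (big_cat_nat (leq0n m) mK) /= lerDl big_nat_cond.
by rewrite sumr_ge0 // => i /andP[/andP[_ /ltnW /Y_ge0]].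
Qed.

(** Consecutive levels give the same weight to a blue vertex with m + 1 white
    neighbours, namely full_weight m.+1. *)
Lemma base_weightS m :
  base_weight m.+1 - base_weight m = m.+1%:R * (Y m - Y m.+1).
Proof. rewrite /base_weight full_weightS -natr1; ring. Qed.

Lemma base_weight_ge0 m : (m <= K)%N -> 0 <= base_weight m.
Proof.
elim: m => [|m IH] mK; first by rewrite /base_weight /full_weight big_ord0 mul0r subr0.
rewrite -(subrK (base_weight m) (base_weight _)) base_weightS.
apply: addr_ge0; last exact: IH (ltnW mK).
by apply: mulr_ge0; rewrite ?subr_ge0 ?Y_decr ?ler0n.
Qed.

Lemma level_room m : (m <= K)%N -> base_weight m + Y m * m%:R <= a.
Proof.
move=> mK; rewrite /base_weight mulrC subrK.
exact: le_trans (full_weight_le mK) full_le_a.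
Qed.

Lemma a_ge0 : 0 <= a.
Proof.
apply: le_trans full_le_a; have := base_weight_ge0 (leqnn K).
by rewrite /base_weight Y_top mulr0 subr0.
Qed.

Lemma level_potential_ge0 m D : (m <= K)%N -> 0 <= level_potential m D.
Proof.
by move=> mK; apply: potential_ge0; rewrite ?base_weight_ge0 ?Y_ge0 ?a_ge0.
Qed.

(** On passing to level m, a blue vertex with w <= m + 1 white neighbours loses
    (m + 1 - w) (Y m - Y (m + 1)), which is nonnegative. *)
Lemma level_potentialS m D : (m < K)%N ->
  (forall x, (#|newly x D| <= m.+1)%N) ->
  level_potential m D <= level_potential m.+1 D.
Proof.
move=> mK small; apply: ler_sum => x _; rewrite /weight.
have [//|xW] := boolP (x \in white D).
have := small x; rewrite card_newly // (negbTE xW) add0n.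
case: (wdeg D x) => [|w] wm; first by rewrite !blue_weight0.
rewrite /blue_weight !mulr1n -subr_ge0.
have -> : base_weight m.+1 + Y m.+1 * w.+1%:R - (base_weight m + Y m * w.+1%:R)
    = (base_weight m.+1 - base_weight m) - w.+1%:R * (Y m - Y m.+1) by ring.
rewrite base_weightS -mulrBl mulr_ge0 ?subr_ge0 ?ler_nat //.
exact: Y_decr.
Qed.

Lemma newlyU1 v x D : (#|newly x (v |: D)| <= #|newly x D|)%N.
Proof.
by apply/subset_leq_card; rewrite /newly whiteU1 setIS // subsetDl.
Qed.

(** The top level has no bound on what a move can dominate: it is the level on
    which the game starts, and its edges have value 0. *)
Definition at_level m D := m = K \/ forall x, (#|newly x D| <= m.+1)%N.

Lemma at_levelU1 m v D : at_level m D -> at_level m (v |: D).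
Proof.
by case=> [|small]; [left | right => x; apply: leq_trans (newlyU1 _ _ _) _].
Qed.

Lemma at_level_wdeg m D : (m <= K)%N -> at_level m D ->
  {in white D, forall u, Y m * (wdeg D u)%:R <= Y m * m%:R}.
Proof.
move=> mK lvl u uW; case: lvl => [-> | small]; first by rewrite Y_top !mul0r.
have := small u; rewrite card_newly // uW ltnS => um.
by rewrite ler_wpM2l ?Y_ge0 ?ler_nat.
Qed.

Lemma staller_drop m v D : (m <= K)%N -> at_level m D -> legal e D v ->
  a + Y m * (d%:R - 2 * m%:R)
    <= level_potential m D - level_potential m (v |: D).
Proof.
move=> mK lvl lv; apply: any_move_drop => //.
- exact: base_weight_ge0.
- exact: Y_ge0.
- exact: leq_trans mK le_Kd.
- exact: level_room.
- exact: at_level_wdeg.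
Qed.

(** The drop is at least s by itself, which settles a game that ends with a move
    of Dominator, and at least 2 s together with the smallest possible drop in
    the answer of Staller. *)
Lemma dominator_drop m D : (m <= K)%N -> at_level m D ->
  (exists x, (m < #|newly x D|)%N) ->
  exists2 v, legal e D v &
    s <= level_potential m D - level_potential m (v |: D) /\
    2 * s <= level_potential m D - level_potential m (v |: D)
             + (a + Y m * (d%:R - 2 * m%:R)).
Proof.
move=> mK lvl rich.
have md := leq_trans mK le_Kd.
have [v lv drop] := rich_move_drop (base_weight_ge0 mK) (Y_ge0 mK)
  sym irr deg md (level_room mK) (at_level_wdeg mK lvl) rich.
exists v => //; rewrite -/(level_potential m D) -/(level_potential m _) in drop *.
have cost := pair_cost mK.
have My : 0 <= m%:R * Y m by rewrite mulr_ge0 ?Y_ge0.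
have Ma : 0 <= m%:R * (a - full_weight m).
  by rewrite mulr_ge0 // subr_ge0 (le_trans (full_weight_le mK)).
have Mdy : 0 <= m%:R * Y m * (d%:R - m%:R).
  by rewrite mulr_ge0 // subr_ge0 ler_nat.
move: (level_potential m D) (level_potential m _) drop cost My Ma Mdy => p q.
rewrite /base_weight; move: (m%:R : rat) (d%:R : rat) (Y m) (full_weight m).
move=> M X y B drop cost My Ma Mdy; split; lra.
Qed.

(** Induction on the number of white vertices for the turns actually played, and
    on the level when Dominator has no rich move left. *)
Lemma game_bound m D : (m <= K)%N -> at_level m D ->
  s * (game_length e true D)%:R <= level_potential m D.
Proof.
move: {2}#|white D|.+1 (ltnSn #|white D|) => N.
elim: N m D => // N IHN m D; rewrite ltnS => leN.
have rich_case k : (k <= K)%N -> at_level k D ->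
    (exists x, (k < #|newly x D|)%N) ->
    s * (game_length e true D)%:R <= level_potential k D.
  move=> kK lvl /(dominator_drop kK lvl) [v lv [alone pair]].
  have [/(_ v lv) len1 _] := game_length_dominator lv.
  have [/existsP[u lu]|/existsPn no_reply] := boolP [exists u, legal e (v |: D) u].
    have [_ [u' lu' len2]] := game_length_staller lu.
    have := IHN k (u' |: (v |: D)) _ kK (at_levelU1 u' (at_levelU1 v lvl)).
    have lt2 : (#|white (u' |: (v |: D))| < N)%N.
      apply: leq_trans (legal_card lu') _.
      exact: leq_trans (ltnW (legal_card lv)) leN.
    move=> /(_ lt2).
    have drop := staller_drop kK (at_levelU1 v lvl) lu'.
    rewrite len2 in len1 => rest.
    apply: le_trans (ler_wpM2l s_ge0 (_ : _ <= _.+2%:R)) _.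
      by rewrite ler_nat; exact: len1.
    by rewrite -addn2 natrD mulrDr mulrC; move: rest; rewrite mulrC; lra.
  have len0 := game_length_nolegal false no_reply.
  have rest := level_potential_ge0 (v |: D) kK.
  rewrite len0 in len1; apply: le_trans (ler_wpM2l s_ge0 (_ : _ <= 1%:R)) _.
    by rewrite ler_nat.
  lra.
elim: m => [|m IHm] mK lvl.
  have [/existsP some|/existsPn none] := boolP [exists x, (0 < #|newly x D|)%N].
    exact: rich_case.
  rewrite game_length_nolegal ?mulr0 ?level_potential_ge0 // => x.
  by rewrite legal_newly.
have [/existsP some|/existsPn none] := boolP [exists x, (m.+1 < #|newly x D|)%N].
  exact: rich_case.
have small x : (#|newly x D| <= m.+1)%N by rewrite leqNgt none.
apply: le_trans (level_potentialS mK small).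
by apply: IHm (ltnW mK) _; right.
Qed.

End Levels.
End Weights.

(** * The numerical weights *)

Section Arithmetic.

Variable x : rat.

Definition white_weight : rat :=
  30 * x ^+ 4 - 56 * x ^+ 3 - 258 * x ^+ 2 + 708 * x - 432.

Definition turn_cost : rat :=
  90 * x ^+ 4 - 390 * x ^+ 3 + 348 * x ^+ 2 + 348 * x - 432.

(** The solution of 2 s = (m + 2) a - m (Y 0 + ... + Y (m - 1))
    + (m + 2) (x - m) Y m for m = 0, 2, 3, 4 and 2 s = 3 a + (3 x - 6) Y 1,
    scaled to have polynomial entries. *)
Definition edge_weight (i : nat) : rat :=
  nth 0 [:: 60 * x ^+ 3 - 334 * x ^+ 2 + 606 * x - 360;
            30 * x ^+ 3 - 144 * x ^+ 2 + 202 * x - 72;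
            15 * x ^+ 3 - 64 * x ^+ 2 + 65 * x;
            6 * x ^+ 3 - 19 * x ^+ 2 + 15 * x] i.

Hypothesis x_ge4 : 4 <= x.

(** All inequalities below hold because the polynomials involved have
    nonnegative coefficients when expanded at 4. *)
Lemma quartic_ge0 (c0 c1 c2 c3 c4 : nat) :
  0 <= c0%:R + c1%:R * (x - 4) + c2%:R * (x - 4) ^+ 2
       + c3%:R * (x - 4) ^+ 3 + c4%:R * (x - 4) ^+ 4.
Proof.
have t_ge0 : 0 <= x - 4 by rewrite subr_ge0.
by rewrite !addr_ge0 // mulr_ge0 // exprn_ge0.
Qed.

Lemma turn_cost_gt0 : 0 < turn_cost.
Proof.
(* The constant coefficient is 4608; one unit is kept for strictness. *)
have := quartic_ge0 4607 7452 4308 1050 90; rewrite /turn_cost; lra.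
Qed.

Lemma edge_weight_decr i : (i < 4)%N -> edge_weight i.+1 <= edge_weight i.
Proof.
case: i => [|[|[|[|i]]]] lti; last by exfalso.
- have := quartic_ge0 208 324 170 30 0; rewrite /edge_weight /=; lra.
- have := quartic_ge0 156 217 100 15 0; rewrite /edge_weight /=; lra.
- have := quartic_ge0 56 122 63 9 0; rewrite /edge_weight /=; lra.
- have := quartic_ge0 140 151 53 6 0; rewrite /edge_weight /=; lra.
Qed.

Lemma full_weight_le_white : full_weight edge_weight 4 <= white_weight.
Proof.
rewrite /full_weight !big_ord_recr big_ord0 /edge_weight /white_weight /=.
have := quartic_ge0 1120 1908 1179 313 30; lra.
Qed.

Lemma edge_weight_pair m : (m <= 4)%N ->
  2 * turn_cost <= (m%:R + 2) * white_weight - m%:R * full_weight edge_weight m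
     + (m%:R + 2) * (x - m%:R) * edge_weight m.
Proof.
case: m => [|[|[|[|[|m]]]]] ltm; last by exfalso.
all: rewrite /full_weight ?big_ord_recr big_ord0 /edge_weight /white_weight.
all: rewrite /turn_cost /=.
- lra.
(* The slack for m = 1 is 3 Y 1 - Y 0. *)
- have := quartic_ge0 496 656 262 30 0; lra.
- lra.
- lra.
- lra.
Qed.

End Arithmetic.

Unset Implicit Arguments.

Theorem theorem2 (d n : nat) (T : finType) (e : rel T) :
  (4 <= d)%N ->
  symmetric e -> irreflexive e ->
  #|T| = n ->
  (d <= min_degree e)%N ->
  (game_domination_number e)%:R <=
    (30 * d%:R ^+ 4 - 56 * d%:R ^+ 3 - 258 * d%:R ^+ 2 + 708 * d%:R - 432)
    / (90 * d%:R ^+ 4 - 390 * d%:R ^+ 3 + 348 * d%:R ^+ 2 + 348 * d%:R - 432)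
    * n%:R :> rat.
Proof.
move=> d4 sym irr Tn degd.
have deg x : (d <= degree e x)%N.
  by apply: leq_trans degd _; apply: bigminn_leq_cond.
have s_gt0 : 0 < turn_cost d%:R by rewrite turn_cost_gt0 ?ler_nat.
have x_ge4 : 4 <= d%:R :> rat by rewrite ler_nat.
have bound := game_bound sym irr deg d4 (edge_weight_decr x_ge4) erefl
  (ltW s_gt0) (full_weight_le_white x_ge4) (edge_weight_pair x_ge4)
  (leqnn 4) (or_introl erefl : at_level e 4 4 set0).
rewrite /level_potential potential_set0 Tn in bound.
change ((game_domination_number e)%:R
        <= white_weight d%:R / turn_cost d%:R * n%:R).
move: (turn_cost _) (white_weight _) s_gt0 bound => s a s_gt0 bound.
by rewrite mulrAC ler_pdivlMr // mulrC.
Qed.
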